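(* Let $\Lambda=\lambda+L\in\mathfrak L_\beta$ be an exponent lattice with reference vector $\lambda$. For every $I\in\mathrm{NS}(\Lambda)$, $$\Lambda_I=\{\lambda+Bm\mid m\in P^{\lambda}_{\Lambda,I}\cap\mathbb Z^{r}\}.$$
   Context: $[n]=\{1,\dots,n\}$. $A\in\mathrm{Mat}_{d\times n}(\mathbb Z)$ has rank $d$, $\beta\in\mathbb C^d$, $L=\mathrm{Ker}_{\mathbb Z}(A)$, $r=n-d=\mathrm{rank}_{\mathbb Z}(L)$. $B\in\mathrm{Mat}_{n\times r}(\mathbb Z)$ is a matrix whose columns form a $\mathbb Z$-basis of $L$ (a Gale dual matrix of $A$). An exponent lattice is a coset $\Lambda=\lambda+L$ with $\lambda\in\mathbb C^n$, $A\lambda=\beta$; $\mathfrak L_\beta$ is the set of all of them. For $\gamma\in\mathbb C^n$, $\mathrm{nsupp}(\gamma)=\{j\in[n]\mid\gamma_j\in\mathbb Z_{<0}\}$; $\Lambda_I=\{\gamma\in\Lambda\mid\mathrm{nsupp}(\gamma)=I\}$; $\mathrm{NS}(\Lambda)=\{I\subset[n]\mid\Lambda_I\ne\emptyset\}$. $E_\Lambda=\{j\in[n]\mid\lambda_j\in\mathbb Z\}$ (independent of the choice of $\lambda\in\Lambda$). The sign polyhedron is $$P^\lambda_{\Lambda,I}=\{m\in\mathbb R^r\mid\lambda_j+(Bm)_j\le-1\ (j\in I),\ \lambda_j+(Bm)_j\ge0\ (j\in E_\Lambda\setminus I)\}.$$ *)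

(* Defs.v *)
From mathcomp Require Import all_boot all_order all_algebra.
From mathcomp Require Import all_classical reals complex.

Set Implicit Arguments.
Unset Strict Implicit.
Unset Printing Implicit Defensive.

Import Order.TTheory GRing.Theory Num.Theory.

Local Open Scope classical_set_scope.
Local Open Scope ring_scope.
Local Open Scope complex_scope.

(* Vectors are columns.  The index set [n] is 'I_n, and the field of complex
   numbers is R[i] for R : realType.  On R[i], x <= y means that x and y have
   the same imaginary part and Re x <= Re y. *)

Definition intmx_rank (d n : nat) (A : 'M[int]_(d, n)) : nat :=
  \rank (map_mx intr A : 'M[rat]_(d, n)).

Definition kerZ (d n : nat) (A : 'M[int]_(d, n)) : set 'cV[int]_n :=
  [set u | A *m u = 0].

Definition gale_dual (d n r : nat) (A : 'M[int]_(d, n)) (B : 'M[int]_(n, r)) :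
  Prop :=
  [/\ forall k : 'I_r, kerZ A (col k B),
      forall c : 'cV[int]_r, B *m c = 0 -> c = 0
    & forall u : 'cV[int]_n, kerZ A u -> exists c : 'cV[int]_r, u = B *m c].

Section ExponentLattices.
Variable R : realType.

Definition coset (d n : nat) (A : 'M[int]_(d, n)) (lambda : 'cV[R[i]]_n) :
  set 'cV[R[i]]_n :=
  [set lambda + map_mx intr u | u in kerZ A].

Definition exponent_lattices (d n : nat) (A : 'M[int]_(d, n))
  (beta : 'cV[R[i]]_d) : set (set 'cV[R[i]]_n) :=
  [set Lambda | exists2 lambda : 'cV[R[i]]_n,
     map_mx intr A *m lambda = beta & Lambda = coset A lambda].

Definition nsupp (n : nat) (gamma : 'cV[R[i]]_n) : set 'I_n :=
  [set j | exists2 z : int, z < 0 & gamma j 0 = z%:~R].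

Definition with_nsupp (n : nat) (Lambda : set 'cV[R[i]]_n) (I : set 'I_n) :
  set 'cV[R[i]]_n :=
  [set gamma | Lambda gamma /\ nsupp gamma = I].

Definition NS (n : nat) (Lambda : set 'cV[R[i]]_n) : set (set 'I_n) :=
  [set I | with_nsupp Lambda I !=set0].

(* E_Lambda, computed from a reference vector; see int_coords_coset. *)
Definition int_coords (n : nat) (lambda : 'cV[R[i]]_n) : set 'I_n :=
  [set j | exists z : int, lambda j 0 = z%:~R].

Lemma int_coords_coset (d n : nat) (A : 'M[int]_(d, n))
  (lambda mu : 'cV[R[i]]_n) :
  coset A lambda mu -> int_coords mu = int_coords lambda.
Proof.
move=> [u _ <-]; apply/seteqP; split=> j [z].
  by rewrite !mxE => e; exists (z - u j 0); rewrite rmorphB /= -e addrK.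
by move=> e; exists (z + u j 0); rewrite !mxE rmorphD /= e.
Qed.

(* lambda + B m in C^n, for m in R^r. *)
Definition affine_point (n r : nat) (B : 'M[int]_(n, r))
  (lambda : 'cV[R[i]]_n) (m : 'cV[R]_r) : 'cV[R[i]]_n :=
  lambda + map_mx (real_complex R) (map_mx intr B *m m).

Definition sign_polyhedron (n r : nat) (B : 'M[int]_(n, r))
  (lambda : 'cV[R[i]]_n) (I : set 'I_n) : set 'cV[R]_r :=
  [set m | (forall j, I j -> affine_point B lambda m j 0 <= -1) /\
           (forall j, (int_coords lambda `\` I) j ->
              0 <= affine_point B lambda m j 0)].

Definition int_points (r : nat) : set 'cV[R]_r :=
  [set m | forall k, m k 0 \is a Num.int].

End ExponentLattices.

Arguments int_points : clear implicits.

(* Main.v *)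
Require Import Defs.
From mathcomp Require Import all_boot all_order all_algebra.
From mathcomp Require Import all_classical reals complex.

(** The columns of [B] span the kernel lattice, so the integral points [m] of
    parameter space parametrize exactly the elements [lambda + B m] of the
    exponent lattice ([affine_point_intr], [coset_gale_dual]).  What remains is
    to recognize, among these, the ones whose negative support is [I].  All
    elements of the lattice have the same integral coordinates, and there is no
    integer strictly between -1 and 0: an integral coordinate belongs to the
    negative support if and only if it is at most -1, and avoids it if and only
    if it is nonnegative.  Coordinates that are not integral never belong to a
    negative support.  Hence, as soon as [I] consists of integral coordinates,
    the sign inequalities say precisely that the negative support is [I]
    ([nsupp_eqP]).  The hypothesis that [I] is the negative support of some
    element of the lattice is what provides this inclusion: without it, a
    coordinate [j] in [I] could be a negative real number that is not an
    integer, and the polyhedron could have integral points although no element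
    of the lattice has negative support [I]. *)

Import Order.TTheory GRing.Theory Num.Theory.

Local Open Scope classical_set_scope.
Local Open Scope ring_scope.
Local Open Scope complex_scope.

Lemma affine_point_intr (R : realType) (n r : nat) (B : 'M[int]_(n, r))
    (lambda : 'cV[R[i]]_n) (c : 'cV[int]_r) :
  affine_point B lambda (map_mx intr c) = lambda + map_mx intr (B *m c).
Proof.
rewrite /affine_point -map_mxM -map_mx_comp; congr (_ + _).
by apply/matrixP => j k; rewrite !mxE /= rmorph_int.
Qed.

Lemma int_pointsE (R : realType) (r : nat) :
  int_points R r = range (map_mx intr : 'cV[int]_r -> 'cV[R]_r).
Proof.
apply/seteqP; split=> [m m_int | _ [c _ <-] k]; last by rewrite mxE intr_int.
exists (map_mx Num.floor m) => //.
by apply/matrixP => k l; rewrite ord1 !mxE (floorK (m_int k)).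
Qed.

Lemma coset_gale_dual {R : realType} {d n r : nat} {A : 'M[int]_(d, n)}
    {B : 'M[int]_(n, r)} (lambda : 'cV[R[i]]_n) :
  gale_dual A B ->
  coset A lambda = range (fun c => lambda + map_mx intr (B *m c)).
Proof.
move=> [B_ker _ B_span]; apply/seteqP; split=> [_ [u /B_span[c ->] <-] | ].
  by exists c.
move=> _ [c _ <-]; exists (B *m c) => //.
have AB0 : A *m B = 0.
  apply/matrixP => i k; have /matrixP/(_ i 0) := B_ker k.
  rewrite !mxE => Bk0; rewrite -[RHS]Bk0.
  by apply: eq_bigr => j _; rewrite mxE.
by rewrite /kerZ /= mulmxA AB0 mul0mx.
Qed.

Lemma nsupp_sub_int_coords {R : realType} {n : nat} {gamma : 'cV[R[i]]_n} :
  nsupp gamma `<=` int_coords gamma.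
Proof. by move=> j [z _ gammaj]; exists z. Qed.

Lemma nsupp_le {R : realType} {n : nat} {gamma : 'cV[R[i]]_n} {j : 'I_n} :
  int_coords gamma j -> nsupp gamma j <-> gamma j 0 <= -1.
Proof.
move=> [z gammaj]; rewrite gammaj -(intrN _ 1) ler_int.
split=> [[w w_lt0] | z_le]; last by exists z => //; apply: le_lt_trans z_le _.
by rewrite gammaj => /intr_inj ->; rewrite -ltzD1 addNr.
Qed.

Lemma not_nsupp_ge {R : realType} {n : nat} {gamma : 'cV[R[i]]_n} {j : 'I_n} :
  int_coords gamma j -> ~ nsupp gamma j <-> 0 <= gamma j 0.
Proof.
move=> [z gammaj]; rewrite gammaj ler0z.
split=> [z_nneg | z_ge0 [w w_lt0]].
  by rewrite leNgt; apply/negP => z_lt0; apply: z_nneg; exists z.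
by rewrite gammaj => /intr_inj zw; rewrite leNgt zw w_lt0 in z_ge0.
Qed.

(** On integral coordinates the two kinds of inequality are complementary, so
    together they decide membership in the negative support; the inclusion of
    [I] excludes coordinates where being at most -1 does not imply being a
    negative integer. *)
Lemma nsupp_eqP {R : realType} {n : nat} {gamma : 'cV[R[i]]_n}
    (I : set 'I_n) :
  I `<=` int_coords gamma ->
  nsupp gamma = I <->
  (forall j, I j -> gamma j 0 <= -1) /\
  (forall j, (int_coords gamma `\` I) j -> 0 <= gamma j 0).
Proof.
move=> I_int; split=> [nsuppI | [I_le I_ge]].
  split=> j; rewrite -nsuppI; first by move=> Ij; apply/nsupp_le=> //;
    exact: nsupp_sub_int_coords.
  by move=> [j_int nIj]; apply/not_nsupp_ge.
apply/seteqP; split=> j => [nj | Ij]; last first.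
  by apply/nsupp_le; [exact: I_int | exact: I_le].
have j_int := nsupp_sub_int_coords _ nj.
by apply: contrapT => nIj; case: (not_nsupp_ge j_int) => _; apply=> //;
  exact: I_ge.
Qed.

Theorem lemma2p1 (R : realType) (d n r : nat) (A : 'M[int]_(d, n))
  (rankA : intmx_rank A = d) (r_def : r = (n - d)%N)
  (B : 'M[int]_(n, r)) (galeB : gale_dual A B)
  (beta : 'cV[R[i]]_d) (Lambda : set 'cV[R[i]]_n) (lambda : 'cV[R[i]]_n)
  (Lambda_beta : exponent_lattices A beta Lambda)
  (Lambda_lambda : Lambda = coset A lambda)
  (I : set 'I_n) (NS_I : NS Lambda I) :
  with_nsupp Lambda I =
  [set affine_point B lambda m
     | m in sign_polyhedron B lambda I `&` int_points R r].
Proof.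
rewrite {}Lambda_lambda in NS_I *.
have I_int : I `<=` int_coords lambda.
  have [gamma0 [gamma0_in <-]] := NS_I.
  by rewrite -(int_coords_coset gamma0_in); apply: nsupp_sub_int_coords.
have nsuppI gamma : coset A lambda gamma -> nsupp gamma = I <->
    (forall j, I j -> gamma j 0 <= -1) /\
    (forall j, (int_coords lambda `\` I) j -> 0 <= gamma j 0).
  move=> gamma_in; rewrite -(int_coords_coset gamma_in).
  by apply: nsupp_eqP; rewrite (int_coords_coset gamma_in).
have cosetE := coset_gale_dual lambda galeB.
have pt_in c : coset A lambda (affine_point B lambda (map_mx intr c)).
  by rewrite affine_point_intr cosetE; exists c.
rewrite int_pointsE; apply/seteqP; split=> gamma.
  move=> [gamma_in]; move: (gamma_in).
  rewrite cosetE => -[c _].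
  rewrite -affine_point_intr => cE; rewrite -cE => /(nsuppI _ (pt_in c)) signs.
  by exists (map_mx intr c) => //; split=> //; exists c.
move=> [m [signs [c _ cE]] <-]; rewrite -{}cE in signs *.
split; first exact: pt_in.
by apply/nsuppI.
Qed.
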